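(* Let $B$ be a simple Bratteli diagram of finite rank. If $\mu(\mathcal O_B(1))=1$, then $\mu(\mathcal P_B)=1$. If $\mu(\mathcal O_B(j))=1$ for some $j>1$, then $\mu(\mathcal P_B)=0$.
   Context: A Bratteli diagram $B$ has levels $V_n$ ($V_0=\{v_0\}$) and edge sets $E_n$ from $V_{n-1}$ to $V_n$ with source/range maps $s,r$; $X_B$ is its Cantor path space; standing assumption: $B$ aperiodic (all tail classes infinite). $B$ is simple if for every $n$ there is $m>n$ with every vertex of $V_n$ joined by a path to every vertex of $V_m$; finite rank means $\sup_n|V_n|<\infty$. An ordering $\omega$ is a linear order on each $r^{-1}(v)$, $v\ne v_0$; $\mathcal O_B=\prod_v P_v$ carries the product measure $\mu=\prod_v\mu_v$, $\mu_v$ uniform on the set $P_v$ of linear orders of $r^{-1}(v)$. $\mathcal O_B(j)$: orderings with exactly $j$ maximal infinite paths. $\omega$ is perfect ($\omega\in\mathcal P_B$) if it admits a Vershik map: a homeomorphism of $X_B$ sending the maximal infinite paths onto the minimal ones and sending each non-maximal $x$ to the path obtained by replacing its first non-maximal edge $x_k$ by its successor $\overline{x_k}$ in $r^{-1}(r(x_k))$ and $(x_1,\dots,x_{k-1})$ by the minimal path from $v_0$ to $s(\overline{x_k})$. *)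

(* Defs.v *)
From mathcomp Require Import all_boot all_order all_algebra.
Set Implicit Arguments. Unset Strict Implicit. Unset Printing Implicit Defensive.
Import Order.TTheory GRing.Theory Num.Theory.

(* Bratteli diagrams.  Levels V 0, V 1, ... ; E n is the (paper's) edge set *)
(* E_{n+1}, with source in V n and range in V n.+1.                         *)
Record bratteli := Bratteli {
  V : nat -> finType;
  E : nat -> finType;
  src : forall n, E n -> V n;
  rng : forall n, E n -> V n.+1;
  V0_single : #|V 0| = 1;
  V_nonempty : forall n, 0 < #|V n|;
  rng_surj : forall n (w : V n.+1), exists e : E n, rng e = w;
  src_surj : forall n (v : V n), exists e : E n, src e = v
}.

Section Bratteli.
Variable B : bratteli.

Definition fib n (w : V B n.+1) : {set E B n} := [set e | rng e == w].

Inductive reach (n : nat) (v : V B n) : forall m, V B m -> Prop :=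
| reach0 : reach v v
| reachS m (e : E B m) : reach v (src e) -> reach v (rng e).

Definition simple_bratteli : Prop :=
  forall n, exists m, n < m /\ forall (v : V B n) (w : V B m), reach v w.

Definition finite_rank : Prop := exists K, forall n, #|V B n| <= K.

Definition pth := forall n, E B n.
Definition is_path (x : pth) : Prop := forall n, rng (x n) = src (x n.+1).

Definition tail_equiv (x y : pth) : Prop := exists N, forall n, N <= n -> x n = y n.

Definition aperiodic : Prop :=
  forall x, is_path x ->
    ~ exists (K : nat) (f : 'I_K -> pth),
        forall y, is_path y -> tail_equiv x y -> exists i, y = f i.

(* Orderings: omega n e is the position (0-based) of e in the linear order *)
(* of r^{-1}(r e).  An element of O_B is a valid such labelling.            *)
Definition ord_fun := forall n, E B n -> nat.

Definition is_ordering (om : ord_fun) : Prop :=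
  (forall n (e : E B n), om n e < #|fib (rng e)|) /\
  (forall n (e e' : E B n), rng e = rng e' -> om n e = om n e' -> e = e').

Definition max_edge (om : ord_fun) n (e : E B n) : Prop :=
  om n e = #|fib (rng e)|.-1.
Definition min_edge (om : ord_fun) n (e : E B n) : Prop := om n e = 0%N.

Definition max_path (om : ord_fun) (x : pth) : Prop :=
  is_path x /\ forall n, max_edge om (x n).
Definition min_path (om : ord_fun) (x : pth) : Prop :=
  is_path x /\ forall n, min_edge om (x n).

Definition O_j (j : nat) (om : ord_fun) : Prop :=
  is_ordering om /\
  exists f : 'I_j -> pth, injective f /\
    forall x, max_path om x <-> exists i, x = f i.

(* continuity on X_B for the product (Cantor) topology *)
Definition path_continuous (phi : pth -> pth) : Prop :=
  forall x, is_path x -> forall N, exists M, forall y, is_path y ->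
    (forall n, n < M -> y n = x n) -> forall n, n < N -> phi y n = phi x n.

Definition homeomorphism_XB (phi : pth -> pth) : Prop :=
  (forall x, is_path x -> is_path (phi x)) /\ path_continuous phi /\
  exists psi : pth -> pth,
    (forall x, is_path x -> is_path (psi x)) /\ path_continuous psi /\
    (forall x, is_path x -> psi (phi x) = x) /\
    (forall x, is_path x -> phi (psi x) = x).

Definition vershik_map (om : ord_fun) (phi : pth -> pth) : Prop :=
  homeomorphism_XB phi /\
  (forall x, max_path om x -> min_path om (phi x)) /\
  (forall y, min_path om y -> exists x, max_path om x /\ phi x = y) /\
  (forall x k, is_path x -> ~ max_edge om (x k) ->
     (forall n, n < k -> max_edge om (x n)) ->
     [/\ rng (phi x k) = rng (x k),
         om k (phi x k) = (om k (x k)).+1,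
         (forall n, k < n -> phi x n = x n) &
         (* (x_1..x_{k-1}) replaced by the minimal path to s(succ x_k);
            phi x is a path, so this determines it uniquely *)
         (forall n, n < k -> min_edge om (phi x n))]).

Definition perfect (om : ord_fun) : Prop :=
  is_ordering om /\ exists phi, vershik_map om phi.

(* The product measure mu = prod_v mu_v (mu_v uniform on P_v).            *)
(* A level-N cylinder  [om0]_N = orderings agreeing with om0 on the edge  *)
(* sets E 0 .. E N.-1 has measure 1 / weight N, where weight N is the     *)
(* number of choices of orderings at the vertices of levels 1..N.         *)
(* Null sets of (the completion of) mu are exactly the subsets of O_B     *)
(* coverable by countably many cylinders of arbitrarily small total mass. *)
Definition weight (N : nat) : nat :=
  \prod_(n < N) \prod_(w : V B n.+1) (#|fib w|)`!.

Definition in_cyl (N : nat) (om0 om : ord_fun) : Prop :=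
  forall n, n < N -> forall e : E B n, om n e = om0 n e.

Definition mu_null (S : ord_fun -> Prop) : Prop :=
  forall k : nat, exists c : nat -> nat * ord_fun,
    (forall om, is_ordering om -> S om -> exists i, in_cyl (c i).1 (c i).2 om) /\
    (forall K, (\sum_(i < K) ((weight (c i).1)%:R : rat)^-1 <= (k.+1%:R)^-1)%R).

Definition mu_full (S : ord_fun -> Prop) : Prop :=
  mu_null (fun om => is_ordering om /\ ~ S om).
Definition mu_zero (S : ord_fun -> Prop) : Prop := mu_null S.

End Bratteli.

(* Main.v *)
Require Import Defs.
From mathcomp Require Import all_boot all_order all_algebra.
From mathcomp Require Import zify ring lra.
From Stdlib Require Import Classical ClassicalEpsilon FunctionalExtensionality.

Set Implicit Arguments. Unset Strict Implicit. Unset Printing Implicit Defensive.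
Import Order.TTheory GRing.Theory Num.Theory.

(** Part 1: reversing all the orders preserves the measure and exchanges maximal
    and minimal paths, so almost surely there is exactly one path of each kind,
    and then compactness makes the successor map extend to a homeomorphism.

    Part 2: let [phi] be a Vershik map and [x1 <> x2] maximal paths, and choose [N]
    such that [phi x1] and [phi x2] differ before level [N].  For a vertex [v] of
    high level let [a v] tell whether the minimal finite path to [v] starts like
    [phi x1], and [b v] whether [phi] sends paths starting with the maximal finite
    path to [v] to paths starting like [phi x1].  Both labels propagate from one
    level to the next along minimal, resp. maximal, edges; consecutive edges
    [e < e'] with the same range satisfy [a (s e') = b (s e)], so that each ordered
    fiber is a walk in a graph in which [v] is an arrow from [a v] to [b v]; and
    [a] is never constant on a level.  If some order on a level is not a walk then
    at least one third of them are not, and by simplicity this happens at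
    infinitely many levels.  There are countably many choices of initial labels. *)

(** * Null sets and finite covers by cylinders *)


Section Covers.
Variable B : bratteli.
Implicit Types (om : ord_fun B) (S : ord_fun B -> Prop) (l : seq (nat * ord_fun B)).

Fixpoint covered l om : Prop :=
  if l is c :: l' then in_cyl c.1 c.2 om \/ covered l' om else False.

Definition mass l : rat := (\sum_(c <- l) ((weight B c.1)%:R)^-1)%R.

Definition fincov S (r : rat) : Prop :=
  exists l, (forall om, is_ordering om -> S om -> covered l om) /\ (mass l <= r)%R.

Lemma covered_cat l1 l2 om : covered (l1 ++ l2) om <-> covered l1 om \/ covered l2 om.
Proof. by elim: l1 => [|c l1 IH] /=; [|rewrite IH]; tauto. Qed.

Lemma covered_nth d l om :
  covered l om -> exists2 i, i < size l & in_cyl (nth d l i).1 (nth d l i).2 om.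
Proof.
elim: l => //= c l IH [h|/IH[i li h]]; first by exists 0.
by exists i.+1.
Qed.

Lemma weight_gt0 N : 0 < weight B N.
Proof. by apply: prodn_gt0 => n; apply: prodn_gt0 => w; apply: fact_gt0. Qed.

Lemma mass_cat l1 l2 : mass (l1 ++ l2) = (mass l1 + mass l2)%R.
Proof. by rewrite /mass big_cat. Qed.

Lemma fincov_sub S T r : (forall om, is_ordering om -> S om -> T om) ->
  fincov T r -> fincov S r.
Proof. by move=> ST [l [cl ml]]; exists l; split=> // om o /(ST _ o)/(cl _ o). Qed.

Lemma fincov_le S (r s : rat) : (r <= s)%R -> fincov S r -> fincov S s.
Proof. by move=> rs [l [cl ml]]; exists l; split=> //; apply: le_trans rs. Qed.

Lemma fincov0 S (r : rat) : (forall om, is_ordering om -> ~ S om) -> (0 <= r)%R -> fincov S r.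
Proof. by move=> S0 r0; exists [::]; split=> [om /S0|] //; rewrite /mass big_nil. Qed.

Lemma fincov_cyl n om : fincov (in_cyl n om) ((weight B n)%:R^-1)%R.
Proof.
exists [:: (n, om)]; split=> [om' _ h|]; first by left.
by rewrite /mass big_seq1.
Qed.

Lemma fincov_big (I : eqType) (s : seq I) (S : I -> ord_fun B -> Prop) (r : rat) :
  (forall i, i \in s -> fincov (S i) r) ->
  fincov (fun om => exists2 i, i \in s & S i om) ((size s)%:R * r)%R.
Proof.
elim: s => [|i s IH] cs; first by apply: fincov0; [move=> om _ []|rewrite mul0r].
have [|l1 [c1 m1]] := IH; first by move=> j js; apply: cs; rewrite inE js orbT.
have [|l2 [c2 m2]] := cs i; first by rewrite mem_head.
exists (l2 ++ l1); split.
  move=> om o [j]; rewrite inE covered_cat => /orP[/eqP->|js] Sj.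
    by left; apply: c2.
  by right; apply: c1 => //; exists j.
by rewrite mass_cat /= -natr1 mulrDl mul1r addrC lerD.
Qed.

(* The elements of [flatten L] are reindexed as one sequence; nonemptiness of
   the [L i] guarantees that the k-th one occurs in the first k.+1 lists. *)
Lemma null_of_lists S :
  (forall k : nat, exists L : nat -> seq (nat * ord_fun B),
    [/\ forall i, 0 < size (L i),
        forall om, is_ordering om -> S om -> exists i, covered (L i) om &
        forall K, (\sum_(i < K) mass (L i) <= (k.+1%:R)^-1)%R]) ->
  mu_null S.
Proof.
move=> H k; have [L [L0 cL mL]] := H k.
pose F K := flatten (mkseq L K); pose d : nat * ord_fun B := (0, fun _ _ => 0).
have FS K : F K.+1 = F K ++ L K by rewrite /F mkseqS flatten_rcons.
have sF K : K <= size (F K).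
  by elim: K => // K IH; rewrite FS size_cat -addn1 leq_add.
have stab i j m : i < size (F j) -> nth d (F (j + m)) i = nth d (F j) i.
  move=> ij; elim: m => [|m IH]; first by rewrite addn0.
  rewrite addnS FS nth_cat IH; case: ltnP => // le.
  suff: i < size (F (j + m)) by rewrite ltnNge le.
  elim: (m) => [|q IHq]; first by rewrite addn0.
  by rewrite addnS FS size_cat (leq_trans IHq) ?leq_addr.
have stab2 i j : i < size (F j) -> nth d (F i.+1) i = nth d (F j) i.
  move=> ij; have [le|/ltnW le] := leqP j i.+1.
    by rewrite -(subnKC le) stab.
  by rewrite -(subnKC le) stab ?sF.
exists (fun i => nth d (F i.+1) i); split.
  move=> om o /(cL _ o)[i ci].
  have /(covered_nth d)[j jF cj]: covered (F i.+1) om by rewrite FS covered_cat; right.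
  by exists j; rewrite (stab2 _ i.+1).
move=> K; have mF : mass (F K) = (\sum_(i < K) mass (L i))%R.
  elim: K => [|K IH]; first by rewrite /F /mass big_ord0 big_nil.
  by rewrite FS mass_cat IH big_ord_recr.
apply: le_trans (mL K); rewrite -mF /mass (big_nth d) big_mkord.
rewrite (eq_bigr (fun i : 'I_K => ((weight B (nth d (F K) i).1)%:R)^-1%R)); last first.
  by move=> i _; rewrite (stab2 _ K) // (leq_trans _ (sF K)).
rewrite (big_ord_widen _ (fun i => ((weight B (nth d (F K) i).1)%:R)^-1%R) (sF K)).
rewrite [leRHS](bigID (fun i : 'I__ => i < K)) /= lerDl.
by apply: sumr_ge0 => c _; rewrite invr_ge0 ler0n.
Qed.

Lemma null_sub S T : (forall om, is_ordering om -> S om -> T om) -> mu_null T -> mu_null S.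
Proof.
move=> ST nT k; have [c [cc mc]] := nT k.
by exists c; split=> // om o /(ST _ o)/(cc _ o).
Qed.

(** Splits the tolerance [1/(k+1)] between two covers, each taken at index [2k+1]. *)
Lemma half_inv k : ((k.*2.+1).+1%:R^-1 + (k.*2.+1).+1%:R^-1 = k.+1%:R^-1 :> rat)%R.
Proof.
have -> : (k.*2.+2 = 2 * k.+1)%N by lia.
rewrite natrM invfM -mulrDl.
by have -> : (2%:R^-1 + 2%:R^-1 = 1 :> rat)%R by []; rewrite mul1r.
Qed.

Lemma null_union S T : mu_null S -> mu_null T -> mu_null (fun om => S om \/ T om).
Proof.
move=> nS nT; apply: null_of_lists => k.
have [c [cc mc]] := nS k.*2.+1; have [d [cd md]] := nT k.*2.+1.
exists (fun i => [:: c i; d i]); split=> //.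
  move=> om o [/(cc _ o)|/(cd _ o)] [i ci]; exists i; first by left.
  by right; left.
move=> K; rewrite -half_inv.
under eq_bigr => i _ do rewrite /mass big_cons big_seq1.
by rewrite big_split lerD.
Qed.

Lemma sum_geom (r : rat) K : (0 <= r)%R -> (\sum_(i < K) r / 2 ^+ i.+1 <= r)%R.
Proof.
move=> r0; have -> : (\sum_(i < K) r / 2 ^+ i.+1 = r - r / 2 ^+ K)%R.
  elim: K => [|K IH]; first by rewrite big_ord0 expr0 divr1 subrr.
  rewrite big_ord_recr /= IH exprS invfM.
  by move: (_ ^-1)%R => x; field.
by rewrite gerBl divr_ge0 // exprn_ge0.
Qed.

Lemma null_union_fincov S (T : nat -> ord_fun B -> Prop) : mu_null S ->
  (forall i (r : rat), (0 < r)%R -> fincov (T i) r) ->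
  mu_null (fun om => S om \/ exists i, T i om).
Proof.
move=> nS nT; apply: null_of_lists => k.
have [c [cc mc]] := nS k.*2.+1.
pose r := ((k.*2.+1).+1%:R^-1 : rat)%R.
have r0 : (0 < r)%R by rewrite invr_gt0 ltr0n.
have ri i : (0 < r / 2 ^+ i.+1)%R by rewrite divr_gt0 // exprn_gt0.
pose l i := proj1_sig (constructive_indefinite_description _ (nT i _ (ri i))).
have lP i : (forall om, is_ordering om -> T i om -> covered (l i) om) /\
    (mass (l i) <= r / 2 ^+ i.+1)%R.
  by rewrite /l; case: constructive_indefinite_description.
(* The head [c i] covers [S] and keeps every list nonempty; the tail [l i] covers [T i]. *)
exists (fun i => c i :: l i); split=> //.
  move=> om o [/(cc _ o)|] [i ci]; exists i; first by left.
  by right; apply: (lP i).1.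
move=> K; rewrite -half_inv.
under eq_bigr => i _ do rewrite /mass big_cons.
rewrite big_split lerD //.
apply: le_trans (sum_geom K (ltW r0)).
by apply: ler_sum => i _; apply: (lP i).2.
Qed.

End Covers.

(** * Orders on one level *)

Section LevelOrders.
Variables (B : bratteli) (n : nat).
Implicit Types (h : E B n -> nat) (w : V B n.+1) (a b : V B n -> bool).

Definition level_order h : bool :=
  [forall e, h e < #|fib (rng e)|] &&
  [forall e, forall e', (rng e == rng e') ==> (h e == h e') ==> (e == e')].

Definition rev_order h (e : E B n) : nat := #|fib (rng e)|.-1 - h e.

(** Along with the reversal, one of the two involutions used to push a walk off the set of walks.
    One-edge fibers are exempt because they have no position 1. *)
Definition swap_order h (e : E B n) : nat :=
  if #|fib (rng e)| <= 1 then h e else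
  if h e == 0 then 1 else if h e == 1 then 0 else h e.

Lemma level_orderP h :
  reflect ((forall e, h e < #|fib (rng e)|) /\
           (forall e e', rng e = rng e' -> h e = h e' -> e = e'))
          (level_order h).
Proof.
apply: (iffP andP) => [[/forallP hb /forallP hi]|[hb hi]]; split=> //.
- move=> e e' re he; have /forallP/(_ e') := hi e.
  by rewrite re he !eqxx => /eqP.
- by apply/forallP.
apply/forallP => e; apply/forallP => e'.
by apply/implyP => /eqP re; apply/implyP => /eqP he; apply/eqP/hi.
Qed.

Lemma fib_gt0 w : 0 < #|fib w|.
Proof. by have [e re] := rng_surj w; apply/card_gt0P; exists e; rewrite inE re. Qed.

Lemma rev_level_order h : level_order h -> level_order (rev_order h).
Proof.
move=> /level_orderP[hb hi]; apply/level_orderP; rewrite /rev_order; split=> [e|e e' re].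
  by have := fib_gt0 (rng e); lia.
have := hb e; have := hb e'; rewrite re => ? ? ?; apply: hi => //.
by lia.
Qed.

Lemma swap_level_order h : level_order h -> level_order (swap_order h).
Proof.
move=> /level_orderP[hb hi]; apply/level_orderP; rewrite /swap_order; split=> [e|e e' re].
  by have := hb e; repeat case: ifP; lia.
rewrite re; case: leqP => _ he; apply: hi => //.
by move: he; repeat case: eqP; lia.
Qed.

Lemma rev_orderK h : level_order h -> rev_order (rev_order h) =1 h.
Proof.
by move=> /level_orderP[hb _] e; rewrite /rev_order; have := hb e; lia.
Qed.

Lemma swap_orderK h : swap_order (swap_order h) =1 h.
Proof.
move=> e; rewrite /swap_order; case: leqP => // _.
by repeat case: eqP; lia.
Qed.

(** An injection of a fiber into as many positions is a bijection. *)
Lemma level_order_onto h w p : level_order h -> p < #|fib w| ->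
  exists2 e, rng e = w & h e = p.
Proof.
move=> /level_orderP[hb hi] pw.
pose f (e : E B n) : 'I_(#|fib w|.-1.+1) := inord (h e).
have k0 := fib_gt0 w.
have hf e : e \in fib w -> f e = h e :> nat.
  by rewrite inE => /eqP re; rewrite inordK // prednK // -re hb.
have injf : {in fib w &, injective f}.
  move=> e e' ew ew' /(congr1 val) /=; rewrite !hf //.
  by move: ew ew'; rewrite !inE => /eqP <- /eqP/esym re /hi; apply.
have /eqP fT : f @: fib w == setT.
  by rewrite eqEcard subsetT cardsT card_ord (card_in_imset injf) /= ltn_predL.
have /imsetP[e ew pe] : inord p \in f @: fib w by rewrite fT inE.
exists e; first by apply/eqP; rewrite inE in ew.
by rewrite -(hf e ew) -pe inordK // prednK.
Qed.

Definition walk a b h : bool :=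
  [forall e, forall e', (rng e == rng e') ==> (h e' == (h e).+1) ==>
     (a (src e') == b (src e))].

Lemma walkP a b h :
  reflect (forall e e', rng e = rng e' -> h e' = (h e).+1 -> a (src e') = b (src e))
          (walk a b h).
Proof.
apply: (iffP forallP) => [H e e' re he|H e].
  by have /forallP/(_ e') := H e; rewrite re he !eqxx => /eqP.
apply/forallP => e'.
by apply/implyP => /eqP re; apply/implyP => /eqP he; apply/eqP/H.
Qed.

Definition all_walk a b : Prop :=
  forall e e' : E B n, rng e = rng e' -> e <> e' -> a (src e') = b (src e).

(** A fiber that is a walk in both directions has labels of period two along its positions, with [a]
    and [b] exchanged at each step. This settles fibers with two edges; in larger ones the swap
    makes two edges of equal parity consecutive, which forces all labels to coincide. *)
Lemma all_walk_of_three a b h : level_order h -> walk a b h ->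
  walk a b (rev_order h) -> walk a b (swap_order h) -> all_walk a b.
Proof.
move=> lh /walkP w1 /walkP w2 /walkP w3.
have [hb hi] := level_orderP _ lh.
have up e e' : rng e = rng e' -> h e' = (h e).+1 ->
    a (src e') = b (src e) /\ a (src e) = b (src e').
  move=> re he; split; first exact: w1.
  apply: w2 => //; rewrite /rev_order re.
  by have := hb e'; lia.
have alt e e' : rng e = rng e' -> h e' = (h e).+2 ->
    a (src e') = a (src e) /\ b (src e') = b (src e).
  move=> re he.
  have [|f rf hf] := level_order_onto (w := rng e) (p := (h e).+1) lh.
    by have := hb e'; rewrite -re; lia.
  have [u1 u2] := @up e f (esym rf) hf.
  have [||v1 v2] := @up f e'; [by rewrite rf|by rewrite hf|].
  by rewrite v1 -u2 -v2 u1.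
move=> e e' re nee.
have k2 : 1 < #|fib (rng e)|.
  by apply/card_gt1P; exists e, e'; rewrite !inE re eqxx; split=> //; apply/eqP.
have [e0 r0 h0] := level_order_onto lh (ltnW k2).
have [e1 r1 h1] := level_order_onto lh k2.
have [||up1 up2] := @up e0 e1; [by rewrite r0|by rewrite h1 h0|].
(* By period two, an edge carries the labels of [e0] or [e1] according to the parity of its
   position. *)
have alts : forall p f, rng f = rng e -> h f = p ->
    a (src f) = a (src (if odd p then e1 else e0)) /\
    b (src f) = b (src (if odd p then e1 else e0)).
  elim/ltn_ind => -[|[|p]] IH f rf hf.
  - by rewrite (hi f e0) ?rf ?r0 ?h0.
  - by rewrite (hi f e1) ?rf ?r1 ?h1.
  have [|g rg hg] := level_order_onto (w := rng e) (p := p) lh.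
    by have := hb f; rewrite rf; lia.
  have [||-> ->] := @alt g f; [by rewrite rf rg|by rewrite hf hg|].
  by rewrite /= negbK; apply: IH.
have [k3|k3] := leqP #|fib (rng e)| 2.
  have := hb e; have := hb e'; rewrite -re => l' l.
  case He : (h e) l => [|[|]] l; case He' : (h e') l' => [|[|]] l'; try lia.
  - by case: nee; apply: hi => //; rewrite He He'.
  - by apply: w1 => //; rewrite He He'.
  - by have [||_ ->] := @up e' e; rewrite ?re ?He ?He'.
  - by case: nee; apply: hi => //; rewrite He He'.
have [e2 r2 h2] := level_order_onto lh k3.
(* After the swap [e0] immediately precedes [e2]. *)
have c : a (src e2) = b (src e0).
  apply: w3; first by rewrite r0 r2.
  by rewrite /swap_order r0 r2 leqNgt k2 h0 h2.
have c' : a (src e0) = b (src e1) by [].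
have [||a2 _] := @alt e0 e2; [by rewrite r0|by rewrite h2 h0|].
have [-> _] := alts _ e' (esym re) erefl; have [_ ->] := alts _ e erefl erefl.
case: (odd _); case: (odd _); rewrite ?up1 -?c' -?c ?a2 //.
Qed.

Local Notation orderT := {ffun E B n -> 'I_(#|E B n|)}.
Local Notation nats o := (fun e => nat_of_ord (o e)).

(** Puts the positions in a finite type so that orders can be counted. The default [enum_rank e] is
    never taken on level orders, whose positions are below [#|E B n|]. *)
Definition ord_of h : orderT := [ffun e => insubd (enum_rank e) (h e)].

Lemma ord_ofE h e : level_order h -> ord_of h e = h e :> nat.
Proof.
move=> /level_orderP[hb _]; rewrite ffunE val_insubd.
by rewrite (leq_trans (hb e)) ?max_card.
Qed.

Definition level_orders : {set orderT} := [set o : orderT | level_order (nats o)].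

Lemma level_order_ext h h' : h =1 h' -> level_order h = level_order h'.
Proof.
move=> hh; apply/level_orderP/level_orderP => -[hb hi]; split=> [e|e e'].
- by rewrite -hh.
- by rewrite -!hh; apply: hi.
- by rewrite hh.
by rewrite !hh; apply: hi.
Qed.

Lemma walk_ext a b h h' : h =1 h' -> walk a b h = walk a b h'.
Proof.
by move=> hh; rewrite /walk; apply: eq_forallb => e; apply: eq_forallb => e'; rewrite !hh.
Qed.

Lemma ord_of_level_orders h : level_order h -> ord_of h \in level_orders.
Proof. by move=> lh; rewrite inE (@level_order_ext _ h) // => e; apply: ord_ofE. Qed.

(** Restriction to the fibers embeds the level orders into the product over [w] of the injections
    from the fiber of [w] to its positions, and there are [(#|fib w|)!] of these. *)
Lemma card_level_orders : #|level_orders| <= \prod_(w : V B n.+1) (#|fib w|)`!.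
Proof.
pose T w : finType := {ffun {e : E B n | rng e == w} -> 'I_(#|fib w|.-1.+1)}.
pose F w : pred (T w) := mem [set f : T w | injectiveb f].
have -> : \prod_(w : V B n.+1) (#|fib w|)`! = #|(family F : simpl_pred {dffun forall w, T w})|.
  rewrite card_family foldrE big_image /=; apply: eq_bigr => w _.
  rewrite /F; have -> : #|mem [set f : T w | injectiveb f]| = #|[set f : T w | injectiveb f]|.
    exact: eq_card.
  rewrite card_inj_ffuns card_ord card_sig prednK ?fib_gt0 //.
  have -> : #|[pred e : E B n | rng e == w]| = #|fib w| by rewrite cardsE.
  by rewrite ffactnn.
pose g (o : orderT) : {dffun forall w, T w} :=
  [ffun w => [ffun e : {e : E B n | rng e == w} => inord (o (val e))]].
have gE o w (e : {e : E B n | rng e == w}) : o \in level_orders -> g o w e = o (val e) :> nat.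
  rewrite inE => /level_orderP[hb _]; rewrite ffunE ffunE inordK // prednK ?fib_gt0 //.
  by have := hb (val e); rewrite (eqP (valP e)).
have gi : {in level_orders &, injective g}.
  move=> o o' ho ho' gg; apply/ffunP => e; apply: val_inj => /=.
  have e1 : rng e == rng e by [].
  by have /= <- := gE o _ (exist _ e e1) ho; rewrite gg gE.
rewrite -(card_in_imset gi); apply: subset_leq_card.
apply/subsetP => _ /imsetP[o ho ->]; apply/familyP => w.
rewrite /F /= inE; apply/injectiveP => e e' /(congr1 val) /=.
rewrite !gE // => he; apply: val_inj.
move: ho; rewrite inE => /level_orderP[_]; apply=> //.
by rewrite (eqP (valP e)) (eqP (valP e')).
Qed.

(** If some order is not a walk, then each walk is moved out of [G] by the reversal or by the swap.
    So all orders are covered by the complement of [G] and its preimages under two injective maps,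
    and the complement has at least a third of them. *)
Lemma card_walk a b : ~ all_walk a b ->
  3 * #|[set o in level_orders | walk a b (nats o)]| <= 2 * #|level_orders|.
Proof.
move=> nab; set G := [set o in _ | _].
have GV : G \subset level_orders by apply/subsetP => o; rewrite inE => /andP[].
pose pull (t : (E B n -> nat) -> E B n -> nat) :=
  [set o in level_orders | ord_of (t (nats o)) \notin G].
(* Extensionality of [t] is assumed because passing through [ord_of] and back only preserves
   functions pointwise. *)
have pullG t : (forall h, level_order h -> level_order (t h)) ->
    (forall h, level_order h -> t (t h) =1 h) ->
    (forall h h', h =1 h' -> t h =1 t h') ->
    #|pull t| <= #|level_orders :\: G|.
  move=> tl tK te; pose f (o : orderT) := ord_of (t (nats o)).
  have fK : {in level_orders &, injective f}.
    suff K : {in level_orders, cancel f f} by apply: can_in_inj K.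
    move=> o; rewrite inE => lo; apply/ffunP => e; apply: val_inj => /=.
    have Et : nats (f o) =1 t (nats o) by move=> e'; rewrite ord_ofE ?tl.
    rewrite {1}/f ord_ofE; last by rewrite tl // (level_order_ext Et) tl.
    by rewrite (te _ _ Et) tK.
  have fKp : {in pull t &, injective f}.
    by move=> o o'; rewrite !inE => /andP[lo _] /andP[lo' _]; apply: fK; rewrite inE.
  rewrite -(card_in_imset fKp); apply: subset_leq_card.
  apply/subsetP => _ /imsetP[o /setIdP[lo ng] ->].
  by rewrite in_setD ng ord_of_level_orders // tl //; rewrite inE in lo.
have r1 := pullG rev_order rev_level_order rev_orderK.
have r2 := pullG swap_order swap_level_order (fun h _ => @swap_orderK h).
have {}r1 : #|pull rev_order| <= #|level_orders :\: G|.
  by apply: r1 => h h' hh e; rewrite /rev_order hh.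
have {}r2 : #|pull swap_order| <= #|level_orders :\: G|.
  by apply: r2 => h h' hh e; rewrite /swap_order hh.
have cov : level_orders \subset (level_orders :\: G) :|: (pull rev_order :|: pull swap_order).
  apply/subsetP => o lo; have lo' : level_order (nats o) by rewrite inE in lo.
  apply/setUP; case g1 : (o \in G); last by left; rewrite in_setD g1 lo.
  right; apply/setUP; case g2 : (ord_of (rev_order (nats o)) \in G); last first.
    by left; apply/setIdP; rewrite g2.
  right; apply/setIdP; split=> //; apply/negP => g3; apply: nab.
  move: g1 g2 g3 => /setIdP[_ g1] /setIdP[_ g2] /setIdP[_ g3].
  apply: (all_walk_of_three lo' g1).
    by rewrite -(walk_ext _ _ (fun e => ord_ofE e (rev_level_order lo'))).
  by rewrite -(walk_ext _ _ (fun e => ord_ofE e (swap_level_order lo'))).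
have := subset_leq_card cov.
have := cardsU (level_orders :\: G) (pull rev_order :|: pull swap_order).
have := cardsU (pull rev_order) (pull swap_order).
have := cardsD level_orders G; rewrite (setIidPr GV).
have := subset_leq_card GV.
lia.
Qed.

End LevelOrders.

(** * Paths *)

Section Paths.
Variable B : bratteli.
Implicit Types (x y z : pth B) (om : ord_fun B).

(** Edges of different levels have different types, so the new entry is transported along
    [n = i]. *)
Definition upd x n (e : E B n) : pth B := fun i =>
  match @eqP _ n i with
  | ReflectT p => eq_rect n (fun k => E B k : Type) e i p
  | ReflectF _ => x i
  end.

Lemma upd_same x n (e : E B n) : upd x e n = e.
Proof. by rewrite /upd; case: eqP => // p; rewrite (eq_axiomK p). Qed.

Lemma upd_other x n (e : E B n) i : i <> n -> upd x e i = x i.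
Proof. by move=> ni; rewrite /upd; case: eqP => // p; case: ni. Qed.

Lemma next_ex n (v : V B n) : exists e : E B n, src e == v.
Proof. by have [e re] := src_surj v; exists e; apply/eqP. Qed.

Definition next n (v : V B n) : E B n := xchoose (next_ex v).

Lemma src_next n (v : V B n) : src (next v) = v.
Proof. exact/eqP/(xchooseP (next_ex v)). Qed.

Fixpoint follow x n i : E B i :=
  match i with
  | 0 => x 0
  | j.+1 => if j < n then x j.+1 else next (rng (follow x n j))
  end.

Lemma path_extend x n (e : E B n) : is_path x -> src (x n) = src e ->
  exists z, [/\ is_path z, forall i, i < n -> z i = x i & z n = e].
Proof.
move=> px sxe; pose z := follow (upd x e) n.
have zE i : i <= n -> z i = upd x e i by rewrite /z; case: i => //= i ->.
have zlt i : i < n -> z i = x i.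
  by move=> lt; rewrite zE ?(ltnW lt) // upd_other // => ein; rewrite ein ltnn in lt.
have zn : z n = e by rewrite zE // upd_same.
exists z; split=> // i; case: (ltnP i n) => [lt|ge]; last first.
  by rewrite {2}/z /= ltnNge ge /= src_next.
rewrite (zlt i lt) px; case: (ltngtP i.+1 n) (lt) => [lt' _|//|eqn _].
  by rewrite zlt.
by subst n; rewrite zn.
Qed.

Lemma follow_path x : is_path (follow x 0).
Proof. by move=> i /=; rewrite src_next. Qed.

(** In general not a path: only a seed for [upd] and [follow]. *)
Definition default_path : pth B := fun i => next (enum_val (Ordinal (V_nonempty B i))).

Definition min_below om n x : Prop := forall i, i < n -> min_edge om (x i).

Lemma level_order_om om n : is_ordering om -> level_order (om n).
Proof. by move=> [hb hi]; apply/level_orderP; split; [apply: hb|apply: hi]. Qed.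

(** Finite paths are represented by infinite ones of which only a prefix matters. The minimal path
    to [v] is built backwards, through the minimal edge into [v] and then recursively to its
    source. *)
Lemma min_path_to om n (v : V B n) : is_ordering om ->
  exists x, [/\ is_path x, src (x n) = v & min_below om n x].
Proof.
move=> oo; elim: n v => [|n IH] v.
  exists (follow (upd default_path (next v)) 0); split=> //; first exact: follow_path.
  by rewrite /= upd_same src_next.
have [e re me] := level_order_onto (level_order_om n oo) (fib_gt0 v).
have [x [px sx mx]] := IH (src e); have [z [pz zx ze]] := path_extend px sx.
exists z; split=> //; first by rewrite -pz ze.
move=> i; rewrite ltnS leq_eqVlt => /orP[/eqP->|lt]; first by rewrite ze.
by rewrite zx //; apply: mx.
Qed.

(** Going down from level [n], each vertex determines the unique minimal edge into it. *)
Lemma min_below_agree om n x y : is_ordering om -> is_path x -> is_path y ->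
  src (x n) = src (y n) -> min_below om n x -> min_below om n y ->
  forall i, i < n -> x i = y i.
Proof.
move=> oo px py; elim: n => // n IH sxy mx my i.
have xyn : x n = y n.
  apply: oo.2; first by rewrite px sxy py.
  by rewrite (mx n (ltnSn n)) (my n (ltnSn n)).
rewrite ltnS leq_eqVlt => /orP[/eqP-> //|]; apply: IH; first by rewrite xyn.
- by move=> j lt; apply/mx/ltnW.
- by move=> j lt; apply/my/ltnW.
Qed.

Definition rev om : ord_fun B := fun n => rev_order (om n).

Lemma rev_ordering om : is_ordering om -> is_ordering (rev om).
Proof.
move=> oo; have l n := rev_level_order (level_order_om n oo).
split=> n; first by have /level_orderP[] := l n.
by have /level_orderP[_] := l n.
Qed.

Lemma revK om n (e : E B n) : is_ordering om -> rev (rev om) e = om n e.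
Proof. by move=> oo; apply: (rev_orderK (level_order_om n oo)). Qed.

Lemma min_rev om n (e : E B n) : is_ordering om -> min_edge (rev om) e <-> max_edge om e.
Proof.
move=> [/(_ n e) + _]; rewrite /min_edge /max_edge /rev /rev_order.
by split; lia.
Qed.

Lemma max_rev om n (e : E B n) : is_ordering om -> max_edge (rev om) e <-> min_edge om e.
Proof.
move=> [/(_ n e) + _]; rewrite /min_edge /max_edge /rev /rev_order.
by split; lia.
Qed.

Definition agree n x y : Prop := forall i, i < n -> x i = y i.

Lemma agree_sym n x y : agree n x y -> agree n y x.
Proof. by move=> h i /h. Qed.

Lemma agree_trans n x y z : agree n x y -> agree n y z -> agree n x z.
Proof. by move=> h k i li; rewrite (h i li) k. Qed.

Lemma agree_le n m x y : n <= m -> agree m x y -> agree n x y.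
Proof. by move=> nm h i lt; apply: h; apply: leq_trans nm. Qed.

(** Sequential compactness of the path space: a prefix shared by terms of arbitrarily large index
    has a one-edge extension with the same property, as each level has finitely many edges. *)
Lemma koenig (X : nat -> pth B) : (forall m, is_path (X m)) ->
  exists2 x, is_path x & forall n M, exists2 m, M <= m & agree n (X m) x.
Proof.
move=> pX; pose often n x := forall M, exists2 m, M <= m & agree n (X m) x.
have step n x : often n x -> exists e : E B n, often n.+1 (upd x e).
  move=> ox; apply: NNPP => /not_ex_all_not nx.
  (* Otherwise each edge [e] stops occurring beyond some [M e], and a late enough term has no edge
     left to use. *)
  have [M HM] : exists M : E B n -> nat, forall e m, M e <= m -> ~ agree n.+1 (X m) (upd x e).
    apply: (@fin_all_exists (E B n) (fun=> nat)
      (fun e M => forall m, M <= m -> ~ agree n.+1 (X m) (upd x e))) => e; have /not_all_ex_not[M HM] := nx e.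
    by exists M => m lm am; apply: HM; exists m.
  have [m lm am] := ox (\max_e M e).
  apply: (HM (X m n) m); first by apply: leq_trans lm; apply: leq_bigmax.
  move=> i; rewrite ltnS leq_eqVlt => /orP[/eqP->|lt]; first by rewrite upd_same.
  by rewrite upd_other ?am // => ein; rewrite ein ltnn in lt.
pose st := {p : nat * pth B | often p.1 p.2}.
pose f n (x : {x | often n x}) : {x | often n.+1 x} :=
  let: exist e oe := constructive_indefinite_description _ (step n _ (proj2_sig x)) in
  exist _ (upd (proj1_sig x) e) oe.
have f_agree n (x : {x | often n x}) : agree n (proj1_sig x) (proj1_sig (f n x)).
  move=> i lt; rewrite /f; case: constructive_indefinite_description => e oe /=.
  by rewrite upd_other // => ein; rewrite ein ltnn in lt.
have o0 : often 0 (X 0) by move=> M; exists M.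
pose F := fix F n : {x | often n x} :=
  if n is m.+1 then f m (F m) else exist _ (X 0) o0.
(* Diagonal limit: entry [n] is final from stage [n.+1] on. *)
pose x : pth B := fun n => proj1_sig (F n.+1) n.
have Fx n d : agree n (proj1_sig (F n)) (proj1_sig (F (n + d))).
  elim: d => [|d IH]; first by rewrite addn0.
  rewrite addnS; apply: agree_trans IH _; apply: agree_le (f_agree _ _).
  exact: leq_addr.
have xF n : agree n x (proj1_sig (F n)).
  by move=> i lt; rewrite /x (Fx i.+1 (n - i.+1)) // subnKC.
have ox n M : exists2 m, M <= m & agree n (X m) x.
  have [m lm am] := proj2_sig (F n) M; exists m => //.
  exact: agree_trans am (agree_sym (xF n)).
exists x => // i; have [m _ am] := ox i.+2 0.
by rewrite -!am // pX.
Qed.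

End Paths.

(** * Existence of the Vershik map *)

Section VershikMap.
Variable B : bratteli.
Implicit Types (x y z : pth B) (om : ord_fun B).

Lemma rev_rev om : is_ordering om -> rev (rev om) = om.
Proof.
move=> oo; apply: functional_extensionality_dep => n.
by apply: functional_extensionality => e; apply: revK.
Qed.

Lemma min_path_rev om x : is_ordering om -> min_path (rev om) x <-> max_path om x.
Proof. by move=> oo; split=> -[px mx]; split=> // n; apply/(min_rev _ oo)/mx. Qed.

Lemma max_path_rev om x : is_ordering om -> max_path (rev om) x <-> min_path om x.
Proof. by move=> oo; split=> -[px mx]; split=> // n; apply/(max_rev _ oo)/mx. Qed.

Definition succ_at om k x z : Prop :=
  [/\ ~ max_edge om (x k), forall i, i < k -> max_edge om (x i) &
   [/\ rng (z k) = rng (x k), om k (z k) = (om k (x k)).+1,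
       forall i, k < i -> z i = x i & min_below om k z]].

(** Only a relation: a maximal path is related to every minimal one. It is single-valued once the
    minimal path is unique. *)
Definition successor om x z : Prop :=
  is_path z /\ (max_path om x /\ min_path om z \/ exists k, succ_at om k x z).

Lemma successor_ex om x : is_ordering om -> (exists y, min_path om y) -> is_path x ->
  exists z, successor om x z.
Proof.
move=> oo [y my] px; have [mx|nmx] := classic (max_path om x).
  by exists y; split; [exact: my.1|left].
have [k k1 k2] : exists2 k, om k (x k) != #|fib (rng (x k))|.-1 &
    forall i, i < k -> max_edge om (x i).
  have : exists k, om k (x k) != #|fib (rng (x k))|.-1.
    apply: NNPP => /not_ex_all_not nk; apply: nmx; split=> // n.
    by apply/eqP; move/negP: (nk n); rewrite negbK.
  case/ex_minnP => k kn kmin; exists k => // i lt; apply/eqP.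
  by apply: contraTT lt => /kmin; rewrite leqNgt.
have [|e re he] := @level_order_onto B k (om k) (rng (x k)) (om k (x k)).+1 (level_order_om k oo).
  by have := oo.1 k (x k); move: k1; lia.
have [u [pu su mu]] := min_path_to (src e) oo.
have [v [pv vu ve]] := path_extend pu su.
pose z : pth B := fun i => if i <= k then v i else x i.
have zle i : i <= k -> z i = v i by rewrite /z => ->.
have zgt i : k < i -> z i = x i by rewrite /z ltnNge => /negPf->.
exists z; split.
  move=> i; case: (ltngtP i k) => [lt|gt|->].
  - by rewrite !zle // ltnW.
  - by rewrite !zgt // ltnW.
  by rewrite zle // zgt // ve re px.
right; exists k; split=> //; first by move/eqP: k1.
split; rewrite ?zle ?ve //.
by move=> i lt; rewrite zle ?(ltnW lt) // vu //; apply: mu.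
Qed.

Lemma first_nonmax_unique om k k' x x' :
  ~ max_edge om (x k) -> (forall i, i < k -> max_edge om (x i)) ->
  ~ max_edge om (x' k') -> (forall i, i < k' -> max_edge om (x' i)) ->
  agree k.+1 x x' -> k = k'.
Proof.
move=> n1 m1 n2 m2 xx; case: (ltngtP k k') => // lt.
  by case: n1; rewrite xx //; apply: m2.
by case: n2; rewrite -xx ?(leqW lt) //; apply: m1.
Qed.

(** The first [k.+1] edges decide where the change takes place and what the new prefix is. This
    locality yields both uniqueness and continuity away from maximal paths. *)
Lemma succ_at_agree om k x z x' z' : is_ordering om -> is_path z -> successor om x' z' ->
  succ_at om k x z -> agree k.+1 x x' ->
  succ_at om k x' z' /\ agree k.+1 z z'.
Proof.
move=> oo pz [pz' [[[_ mx'] _]|[k' s']]] s xx'.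
  by case: s => nm _ _; case: nm; rewrite xx'.
have [n1 m1 [r1 h1 t1 l1]] := s; have [n2 m2 _] := s'.
have kk : k = k' by apply: (first_nonmax_unique n1 m1 n2 m2 xx').
subst k'; split=> //; have [_ _ [r2 h2 t2 l2]] := s'.
have zk : z k = z' k by apply: oo.2; rewrite ?r1 ?r2 ?h1 ?h2 xx'.
move=> i; rewrite ltnS leq_eqVlt => /orP[/eqP-> //|].
by apply: (min_below_agree oo pz pz'); rewrite ?zk.
Qed.

Definition unique_min om : Prop :=
  exists2 y, min_path om y & forall y', min_path om y' -> y' = y.

Lemma successor_unique om x z z' : is_ordering om -> unique_min om ->
  successor om x z -> successor om x z' -> z = z'.
Proof.
move=> oo [y _ yu] s s'; apply: functional_extensionality_dep => i.
case: s => pz [[mx mz]|[k sk]].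
  case: s' => _ [[_ mz']|[k [nm _ _]]]; first by rewrite (yu _ mz) (yu _ mz').
  by case: nm; apply: mx.2.
have [sk' zz] := succ_at_agree oo pz s' sk (fun i _ => erefl (x i)).
have [le|gt] := leqP i k; first exact: zz.
have [_ _ [_ _ t _]] := sk; have [_ _ [_ _ t' _]] := sk'.
by rewrite t ?t'.
Qed.

(** Reversal turns successors into predecessors, so the inverse of the successor map is the
    successor map of [rev om]. *)
Lemma successor_rev om x z : is_ordering om -> is_path x ->
  successor om x z -> successor (rev om) z x.
Proof.
move=> oo px [pz [[mx mz]|[k [n m [r h t l]]]]]; split=> //.
  by left; split; [apply/max_path_rev|apply/min_path_rev].
right; exists k; split.
- by move=> /(max_rev _ oo); rewrite /min_edge h.
- by move=> i lt; apply/(max_rev _ oo)/l.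
split=> //.
- rewrite /rev /rev_order r; have := oo.1 k (z k); rewrite h r; lia.
- by move=> i lt; rewrite t.
by move=> i lt; apply/(min_rev _ oo)/m.
Qed.

(** Otherwise paths with ever longer minimal prefixes stay away from [y], and a limit of them is a
    second minimal path. *)
Lemma near_min om y N : (forall y', min_path om y' -> y' = y) ->
  exists M, forall z, is_path z -> min_below om M z -> agree N z y.
Proof.
move=> yu; apply: NNPP => /not_ex_all_not nM.
have H M : exists z, [/\ is_path z, min_below om M z & ~ agree N z y].
  apply: NNPP => /not_ex_all_not nz; apply: (nM M) => z pz mz.
  by apply: NNPP => na; apply: (nz z).
pose X M := proj1_sig (constructive_indefinite_description _ (H M)).
have XP M : [/\ is_path (X M), min_below om M (X M) & ~ agree N (X M) y].
  by rewrite /X; case: constructive_indefinite_description.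
have [|x px ax] := @koenig B X; first by move=> m; case: (XP m).
have mx : min_path om x.
  split=> // n; have [m lm am] := ax n.+1 n.+1.
  by rewrite -am //; have [_ + _] := XP m; apply.
have [m _ am] := ax N 0; have [_ _] := XP m; apply.
by rewrite -(yu x mx).
Qed.

(** Near a maximal path the images have long minimal prefixes, hence are close to the unique minimal
    path; near any other path the change is local. *)
Lemma successor_continuous om phi : is_ordering om -> unique_min om ->
  (forall x, is_path x -> successor om x (phi x)) -> path_continuous phi.
Proof.
move=> oo [y my yu] sphi x px N; have [pz [[mx mz]|[k sk]]] := sphi x px.
  have [M HM] := near_min N yu; exists M => x' px' xx'.
  rewrite (yu _ mz); have [pz' s'] := sphi x' px'; apply: HM => // i lt.
  case: s' => [[_ mz']|[k [nm _ [_ _ _ ml]]]]; first exact: mz'.2.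
  apply: ml; rewrite ltnNge; apply/negP => le; apply: nm.
  by rewrite xx' ?(leq_ltn_trans le) //; apply: mx.2.
(* Agreement on [k.+1] edges fixes the new prefix, agreement on [N] edges fixes the tail. *)
exists (k.+1 + N) => x' px' xx' n lt.
have [sk' zz] := succ_at_agree oo pz (sphi x' px') sk
  (fun i h => esym (xx' i (leq_trans h (leq_addr _ _)))).
have [le|gt] := leqP n k; first by rewrite zz.
have [_ _ [_ _ t _]] := sk; have [_ _ [_ _ t' _]] := sk'.
by rewrite t // t' // xx' // (leq_trans lt) ?leq_addl.
Qed.

Lemma perfect_of_unique om : is_ordering om -> unique_min om -> unique_min (rev om) ->
  perfect om.
Proof.
move=> oo um ur; have ro := rev_ordering oo.
have emp (o : ord_fun B) : unique_min o -> exists y, min_path o y by case=> y; exists y.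
have succ_map (o : ord_fun B) : is_ordering o -> unique_min o ->
    exists f : pth B -> pth B, forall x, is_path x -> successor o x (f x).
  move=> oo' uo; exists (fun x => epsilon (inhabits x) (successor o x)) => x px.
  by apply: epsilon_spec; apply: successor_ex => //; apply: emp.
have [phi sphi] := succ_map _ oo um; have [psi spsi] := succ_map _ ro ur.
split=> //; exists phi; split; [|split; [|split]].
- split; first by move=> x /sphi[].
  split; first exact: successor_continuous sphi.
  exists psi; split; first by move=> x /spsi[].
  split; first exact: successor_continuous spsi.
  split=> x px.
    apply: (successor_unique ro ur (spsi _ (sphi _ px).1)).
    exact/successor_rev/sphi.
  apply: (successor_unique oo um (sphi _ (spsi _ px).1)).
  by rewrite -(rev_rev oo); apply/successor_rev/spsi.
- move=> x mx; have [_ [[]|[k [nm _ _]]]] := sphi x mx.1 => //.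
  by case: nm; apply: mx.2.
- move=> y my; have [x mx xu] := ur; exists x.
  have {}mx : max_path om x by apply/min_path_rev.
  split=> //; have [y0 _ yu] := um; rewrite (yu _ my); apply: yu.
  have [_ [[]|[k [nm _ _]]]] := sphi x mx.1 => //.
  by case: nm; apply: mx.2.
move=> x k px nm m; have [_ [[mx _]|[k' [n' m' s]]]] := sphi x px.
  by case: nm; apply: mx.2.
by have -> // : k = k' := first_nonmax_unique nm m n' m' (fun i _ => erefl (x i)).
Qed.

Lemma O_1_unique om : O_j 1 om -> unique_min (rev om).
Proof.
move=> [oo [f [_ fP]]]; exists (f ord0).
  by apply/min_path_rev => //; apply/fP; exists ord0.
by move=> x /(min_path_rev x oo)/fP[i ->]; rewrite ord1.
Qed.

(** Reversal carries cylinders to cylinders of the same level, hence of the same mass. *)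
Lemma null_rev (S : ord_fun B -> Prop) :
  mu_null S -> mu_null (fun om => S (rev om)).
Proof.
move=> nS k; have [c [cc mc]] := nS k; exists (fun i => ((c i).1, rev (c i).2)); split=> //.
move=> om oo /(cc _ (rev_ordering oo))[i ci]; exists i => n lt e /=.
by rewrite -(revK e oo) /rev /rev_order /= -ci.
Qed.

Lemma perfect_full : mu_full (@O_j B 1) -> mu_full (@perfect B).
Proof.
move=> n1; apply: null_sub (null_union n1 (null_rev n1)) => om oo [_ np].
have ro := rev_ordering oo; have [o1|o1] := classic (O_j 1 om); last by left.
right; split=> // o2; apply: np; apply: perfect_of_unique => //; last exact: O_1_unique.
by rewrite -(rev_rev oo); apply: O_1_unique.
Qed.

End VershikMap.

(** * Propagated labels *)

Section Labels.
Variables (B : bratteli) (n0 : nat) (bs cs : seq bool).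
Implicit Types (om : ord_fun B).

(** Up to level [n0] labels are read off [ds]; above it a vertex takes the label of the source of
    its minimal edge. Taking [rev om] propagates along maximal edges instead. A finite list keeps
    the initial data countable. *)
Fixpoint lab (ds : seq bool) om n : V B n -> bool :=
  match n return V B n -> bool with
  | 0 => fun v => nth false ds (enum_rank v)
  | m.+1 => fun w => if m < n0 then nth false ds (enum_rank w) else
      [exists e : E B m, (rng e == w) && (om m e == 0) && lab ds om (src e)]
  end.

Notation amin om := (@lab bs om _).
Notation amax om := (@lab cs (rev om) _).

Definition alive om : Prop := forall n, n0 <= n ->
  walk (@lab bs om n) (@lab cs (rev om) n) (om n) /\
  exists v v' : V B n, amin om v <> amin om v'.

Definition settled om n : Prop := all_walk (@lab bs om n) (@lab cs (rev om) n).

(** The labels on level [n] depend only on the orders below, so they are constant on a cylinder of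
    level [n] while the order of the edges in [E B n] is still free. *)
Lemma lab_local ds om om' n : in_cyl n om om' -> @lab ds om' n =1 @lab ds om n.
Proof.
elim: n => //= n IH h w; case: ifP => // _; apply: eq_existsb => e.
by rewrite h // IH // => i lt; apply: h; apply: leqW.
Qed.

Lemma in_cyl_rev n om om' : in_cyl n om om' -> in_cyl n (rev om) (rev om').
Proof. by move=> h i lt e; rewrite /rev /rev_order h. Qed.

Lemma in_cyl_le m n om om' : m <= n -> in_cyl n om om' -> in_cyl m om om'.
Proof. by move=> mn h i lt; apply: h; apply: leq_trans mn. Qed.

Lemma settled_local n om om' : in_cyl n om om' -> settled om n -> settled om' n.
Proof.
by move=> h s e e' re ee; rewrite !(lab_local _ h) (lab_local _ (in_cyl_rev h)); apply: s.
Qed.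

Lemma lab_rng ds om n (e : E B n) : is_ordering om -> n0 <= n -> min_edge om e ->
  lab ds om (rng e) = lab ds om (src e).
Proof.
move=> oo le me /=; rewrite ltnNge le /=.
apply/existsP/idP => [[e' /andP[/andP[/eqP re /eqP he]]]|l]; last first.
  by exists e; rewrite eqxx me eqxx.
by have -> : e' = e by apply: oo.2; rewrite ?re ?he ?me.
Qed.

Lemma lab_rng_max om n (e : E B n) : is_ordering om -> n0 <= n -> max_edge om e ->
  amax om (rng e) = amax om (src e).
Proof. by move=> oo le me; apply: lab_rng (rev_ordering oo) le _; apply/min_rev. Qed.

(** A one-edge fiber copies both labels. Otherwise the first and last edges are distinct, and
    [settled] applied to them equates the two labels of the range. *)
Lemma settled_cases om n (e : E B n) : is_ordering om -> n0 <= n -> settled om n ->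
  amin om (rng e) = amin om (src e) /\ amax om (rng e) = amax om (src e) \/
  amin om (rng e) = amax om (rng e).
Proof.
move=> oo le s; have lo := level_order_om n oo.
have [e0 r0 h0] := level_order_onto lo (fib_gt0 (rng e)).
have [e1 r1 h1] : exists2 e1, rng e1 = rng e & om n e1 = #|fib (rng e)|.-1.
  by apply: level_order_onto => //; rewrite ltn_predL fib_gt0.
have A0 := lab_rng bs oo le h0.
have A1 : amax om (rng e1) = amax om (src e1) by apply: lab_rng_max => //; rewrite /max_edge h1 r1.
have [e01|ne] := eqVneq e0 e1; last first.
  right; rewrite -r0 A0 r0 -r1 A1; apply: s; first by rewrite r0 r1.
  by move=> ee; rewrite ee eqxx in ne.
left; have e0e : e0 = e.
  by apply: oo.2 => //; have := oo.1 n e; have := h1; rewrite -e01 h0; lia.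
by move: A0 A1; rewrite -e01 e0e.
Qed.

(** A vertex that is not a loop copies both labels of its predecessor, which is then not a loop
    either; this goes down to level [n]. *)
Lemma settled_const om n m (v : V B n) (w : V B m) : is_ordering om -> n0 <= n ->
  reach v w -> n <= m /\ ((forall i, n <= i < m -> settled om i) ->
    amin om w <> amax om w -> amin om w = amin om v).
Proof.
move=> oo le; elim=> [//|m' e r [nm IH]]; split; first exact: leqW.
move=> s nw; have sm : settled om m' by apply: s; rewrite nm ltnS leqnn.
have [[eqa eqb]|//] := settled_cases e oo (leq_trans le nm) sm.
rewrite eqa; apply: IH; last by rewrite -eqa -eqb.
by move=> i /andP[ni im]; apply: s; rewrite ni ltnS ltnW.
Qed.

(** If all predecessors are loops, a settled fiber gives equal labels to all of its sources, so the
    label is carried along every edge. *)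
Lemma settled_loops om n m (v : V B n) (w : V B m) : is_ordering om -> n0 <= n ->
  (forall u : V B n, amin om u = amax om u) ->
  reach v w -> n <= m /\ ((forall i, n <= i < m -> settled om i) ->
    amin om w = amax om w /\ amin om w = amin om v).
Proof.
move=> oo le lp; elim=> [//|m' e r [nm IH]]; split; first exact: leqW.
move=> s; have sm : settled om m' by apply: s; rewrite nm ltnS leqnn.
have [|le1 <-] := IH; first by move=> i /andP[ni im]; apply: s; rewrite ni ltnS ltnW.
have [[-> ->]//|lw] := settled_cases e oo (leq_trans le nm) sm.
split=> //; have [e0 r0 h0] := level_order_onto (level_order_om m' oo) (fib_gt0 (rng e)).
rewrite -r0 (lab_rng bs oo (leq_trans le nm) h0).
have [->//|/eqP ne] := eqVneq e0 e.
by rewrite le1; apply: sm => //; apply: nesym.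
Qed.

(* On a settled level a new vertex either copies the arrow of its only
   predecessor or is a loop.  Hence all vertices are loops once every vertex is
   reached from all of level [n], and one more round of simplicity makes the label
   constant, against [alive]. *)
Lemma settled_bounded n : simple_bratteli B -> n0 <= n -> exists2 m, n <= m &
  forall om, is_ordering om -> alive om -> ~ (forall i, n <= i < m -> settled om i).
Proof.
move=> sB le; have [m1 [nm1 r1]] := sB n; have [m2 [nm2 r2]] := sB m1.
exists m2; first by apply/ltnW/(ltn_trans nm1).
move=> om oo al s; have le1 : n0 <= m1 by apply/ltnW/(leq_ltn_trans le).
have lp (u : V B m1) : amin om u = amax om u.
  apply: NNPP => nu; have [_ [v [v' []]]] := al n le.
  have [_ H] := settled_const oo le (r1 v u); have [_ H'] := settled_const oo le (r1 v' u).
  have sm1 i : n <= i < m1 -> settled om i.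
    by move=> /andP[ni im]; apply: s; rewrite ni (ltn_trans im).
  by rewrite -(H sm1 nu) -(H' sm1 nu).
have [_ [v [v' []]]] := al m1 le1.
have /card_gt0P[w _] := V_nonempty B m2.
have sm2 i : m1 <= i < m2 -> settled om i.
  by move=> /andP[mi im]; apply: s; rewrite im (leq_trans (ltnW nm1)).
have [_ /(_ sm2)[_ <-]] := settled_loops oo le1 lp (r2 v w).
by have [_ /(_ sm2)[_ <-]] := settled_loops oo le1 lp (r2 v' w).
Qed.

End Labels.

(** * Small covers of the orderings with propagated labels *)

Section CoverAlive.
Variable B : bratteli.
Implicit Types (om : ord_fun B) (S : ord_fun B -> Prop).

Lemma weightS n : weight B n.+1 = weight B n * \prod_(w : V B n.+1) (#|fib w|)`!.
Proof. by rewrite /weight big_ord_recr. Qed.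

(** Splits a cylinder of level [n] by the order on the next edge set: at most [#|G|] pieces meet
    [S], and each lies in one cylinder of level [n.+1]. *)
Lemma fincov_step S n om (G : {set {ffun E B n -> 'I_(#|E B n|)}}) (r : rat) :
  (0 <= r)%R ->
  (forall om', is_ordering om' -> S om' -> in_cyl n om om' ->
     ord_of (om' n) \in G /\
     fincov (fun om2 => S om2 /\ in_cyl n.+1 om' om2) (r / (weight B n.+1)%:R)%R) ->
  fincov (fun om2 => S om2 /\ in_cyl n om om2) (#|G|%:R * (r / (weight B n.+1)%:R))%R.
Proof.
move=> r0 H; pose T o om2 := [/\ S om2, in_cyl n om om2 & ord_of (om2 n) = o].
rewrite cardE; apply: (@fincov_sub _ _ (fun om2 => exists2 o, o \in enum G & T o om2)).
  move=> om2 o2 [s2 c2]; exists (ord_of (om2 n)); last by [].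
  by rewrite mem_enum; apply: (H _ o2 s2 c2).1.
apply: fincov_big => o _.
(* A nonempty piece is covered through a representative [om']; an empty one by the empty list. *)
have [[om' [o' [s' c' ordo']]]|nT] := classic (exists om', is_ordering om' /\ T o om').
  apply: fincov_sub (H om' o' s' c').2 => om2 o2 [s2 c2 ordo2]; split=> // i.
  rewrite ltnS leq_eqVlt => /orP[/eqP ein|lt] e; last by rewrite c2 ?c'.
  subst i; rewrite -(ord_ofE e (level_order_om n o2)) ordo2 -ordo'.
  by rewrite (ord_ofE e (level_order_om n o')).
apply: fincov0; last by rewrite divr_ge0 // ler0n.
by move=> om2 o2 t2; apply: nT; exists om2.
Qed.

(** Read [r] as a mass relative to the cylinder: a level on which only a proportion [q] of the
    orders is allowed multiplies it by [q]. *)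
Lemma fincov_step_ratio S n om (G : {set {ffun E B n -> 'I_(#|E B n|)}}) (r q : rat) :
  (0 <= r)%R -> (#|G|%:R <= q * (\prod_(w : V B n.+1) (#|fib w|)`!)%:R)%R ->
  (forall om', is_ordering om' -> S om' -> in_cyl n om om' ->
     ord_of (om' n) \in G /\
     fincov (fun om2 => S om2 /\ in_cyl n.+1 om' om2) (r / (weight B n.+1)%:R)%R) ->
  fincov (fun om2 => S om2 /\ in_cyl n om om2) (q * r / (weight B n)%:R)%R.
Proof.
move=> r0 hG /(fincov_step r0); apply: fincov_le.
have := weight_gt0 B n.+1; rewrite weightS muln_gt0 => /andP[w0 p0].
rewrite natrM invfM (mulrA r) (mulrC (r / _))%R mulrA -(mulrA q).
rewrite ler_wpM2r ?divr_ge0 ?ler0n //.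
by rewrite ler_pdivrMr // ltr0n.
Qed.

Lemma in_level_orders om n : is_ordering om -> ord_of (om n) \in level_orders B n.
Proof. by move=> oo; apply/ord_of_level_orders/level_order_om. Qed.

(** Each unsettled level costs a factor [2/3], and [settled_bounded] provides one before a level [m]
    that depends only on [n]. The induction on [k] counts these levels. *)
Lemma fincov_alive_cyl n0 bs cs k n om : simple_bratteli B -> is_ordering om ->
  alive n0 bs cs om -> n0 <= n ->
  fincov (fun om2 => alive n0 bs cs om2 /\ in_cyl n om om2)
    ((2 / 3) ^+ k / (weight B n)%:R)%R.
Proof.
move=> sB; elim: k => [|k IH] in n om * => oo al le.
  by rewrite expr0 mul1r; apply: fincov_sub (fincov_cyl n om) => om2 _ [].
have q0 j := exprn_ge0 j (isT : (0 <= 2 / 3 :> rat)%R).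
have lec (i : nat) : (#|level_orders B i|%:R <=
    (\prod_(w : V B i.+1) (#|fib w|)`!)%:R :> rat)%R by rewrite ler_nat card_level_orders.
have [m nm hm] := settled_bounded bs cs sB le.
(* Search for the first unsettled level, [d] being the distance left to [m]. Settled levels are
   crossed with factor 1; [d = 0] is impossible. *)
suff main d i om' : i + d = m -> n <= i -> is_ordering om' -> alive n0 bs cs om' ->
    (forall j, n <= j < i -> settled n0 bs cs om' j) ->
    fincov (fun om2 => alive n0 bs cs om2 /\ in_cyl i om' om2)
      ((2 / 3) ^+ k.+1 / (weight B i)%:R)%R.
  apply: (main (m - n)) => //; first exact: subnKC.
  by move=> j /andP[nj /(leq_ltn_trans nj)]; rewrite ltnn.
elim: d => [|d IHd] in i om' *.
  by rewrite addn0 => -> _ oo' al' s; case: (hm om' oo' al').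
rewrite addnS -addSn => im ni oo' al' s.
have [si|nsi] := classic (settled n0 bs cs om' i).
  rewrite -[(_ ^+ k.+1)%R]mul1r; apply: (@fincov_step_ratio _ _ _ (level_orders B i)) => //.
    by rewrite mul1r.
  move=> om2 o2 s2 c2; split; first exact: in_level_orders.
  apply: IHd => //; first exact: leqW.
  move=> j /andP[nj]; rewrite ltnS leq_eqVlt => /orP[/eqP->|lt].
    exact: settled_local si.
  apply: (settled_local (in_cyl_le _ c2)); first exact: ltnW.
  by apply: s; rewrite nj.
rewrite exprS.
(* By locality the labels of [om'] are those of every ordering in its cylinder of level [i], so a
   single [G] serves them all. *)
pose G := [set o in level_orders B i |
  walk (@lab B n0 bs om' i) (@lab B n0 cs (rev om') i) (fun e => nat_of_ord (o e))].
have cG : 3 * #|G| <= 2 * #|level_orders B i| := card_walk nsi.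
apply: (@fincov_step_ratio _ _ _ G) => //.
  have := ler_wpM2l (isT : (0 <= 2 / 3 :> rat)%R) (lec i); apply: le_trans.
  have : ((3 * #|G|)%:R <= (2 * #|level_orders B i|)%:R :> rat)%R by rewrite ler_nat.
  rewrite !natrM; lra.
move=> om2 o2 s2 c2; split; last by apply: IH => //; apply/leqW/(leq_trans le).
apply/setIdP; split; first exact: in_level_orders.
have [/walkP w _] := s2 i (leq_trans le ni); apply/walkP => e e' re.
rewrite !(ord_ofE _ (level_order_om i o2)) => /(w _ _ re).
by rewrite (lab_local n0 bs c2) (lab_local n0 cs (in_cyl_rev c2)).
Qed.

Lemma two_thirds_small (r : rat) : (0 < r)%R -> exists k, ((2 / 3) ^+ k <= r)%R.
Proof.
(* The product does not increase with [k], since [2(k+3) <= 3(k+2)]. *)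
move=> r0; have h k : ((2 / 3 : rat) ^+ k * (k.+2)%:R <= 2)%R.
  elim: k => [|k IH]; first by rewrite expr0 mul1r.
  rewrite exprS; have := exprn_ge0 k (isT : (0 <= 2 / 3 :> rat)%R).
  move: IH; rewrite -(addn2 k) -(addn1 (k + 2)) !natrD; move: (_ ^+ k)%R => x.
  have : (0 <= k%:R :> rat)%R by rewrite ler0n.
  move: (k%:R)%R => y y0 IH x0; have xy := mulr_ge0 x0 y0; lra.
have /archi_boundP : (0 <= 2 / r)%R by rewrite divr_ge0 // ltW.
move: (Num.bound _) => k hk; exists k.
have k0 : (0 < k.+2%:R :> rat)%R by rewrite ltr0n.
rewrite -(ler_pM2r k0); apply: le_trans (h k) _.
move: hk; rewrite ltr_pdivrMr // -addn2 natrD => hk; nra.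
Qed.

(** Levels below [n0] are crossed with factor 1, starting from the cylinder of level 0, which
    contains everything and has weight 1. *)
Lemma fincov_alive n0 bs cs (r : rat) : simple_bratteli B -> (0 < r)%R ->
  fincov (@alive B n0 bs cs) r.
Proof.
move=> sB /two_thirds_small[k hk]; apply: (fincov_le hk).
have q0 := exprn_ge0 k (isT : (0 <= 2 / 3 :> rat)%R).
suff H n d om : n + d = n0 -> is_ordering om -> alive n0 bs cs om ->
    fincov (fun om2 => alive n0 bs cs om2 /\ in_cyl n om om2)
      ((2 / 3) ^+ k / (weight B n)%:R)%R.
  have [[om [oo al]]|no] := classic (exists om, is_ordering om /\ @alive B n0 bs cs om).
    have := H 0 n0 om (add0n _) oo al.
    rewrite /weight big_ord0 divr1 => c; apply: fincov_sub c => om2 _ s2.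
    by split.
  by apply: fincov0 => // om oo al; apply: no; exists om.
elim: d => [|d IH] in n om *.
  by rewrite addn0 => -> oo al; apply: fincov_alive_cyl.
rewrite addnS -addSn => nd oo al.
rewrite -[(_ ^+ k)%R]mul1r; apply: (@fincov_step_ratio _ _ _ (level_orders B n)) => //.
  by rewrite mul1r ler_nat card_level_orders.
by move=> om2 o2 s2 c2; split; [exact: in_level_orders|exact: IH].
Qed.

End CoverAlive.

(** * Perfect orderings with two maximal paths *)

Section PerfectAlive.
Variable B : bratteli.
Implicit Types (x y z : pth B) (om : ord_fun B).

(** Heine-Cantor: a sequence of counterexamples would violate continuity at a limit given by
    [koenig]. *)
Lemma uniform_modulus phi N : path_continuous phi -> exists M, forall x x',
  is_path x -> is_path x' -> agree M x x' -> agree N (phi x) (phi x').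
Proof.
move=> cphi; apply: NNPP => /not_ex_all_not nM.
have H M : exists p : pth B * pth B, [/\ is_path p.1, is_path p.2,
    agree M p.1 p.2 & ~ agree N (phi p.1) (phi p.2)].
  apply: NNPP => /not_ex_all_not np; apply: (nM M) => x x' px px' xx'.
  by apply: NNPP => na; apply: (np (x, x')).
pose X M := proj1_sig (constructive_indefinite_description _ (H M)).
have XP M : [/\ is_path (X M).1, is_path (X M).2,
    agree M (X M).1 (X M).2 & ~ agree N (phi (X M).1) (phi (X M).2)].
  by rewrite /X; case: constructive_indefinite_description.
have [|x px ax] := @koenig B (fun m => (X m).1); first by move=> m; case: (XP m).
have [M HM] := cphi x px N; have [m lm am] := ax M M.
have [p1 p2 a12 []] := XP m.
have a2 : agree M (X m).2 x := agree_trans (agree_sym (agree_le lm a12)) am.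
exact: agree_trans (HM _ p1 am) (agree_sym (HM _ p2 a2)).
Qed.

Definition decide (P : Prop) : bool := if excluded_middle_informative P then true else false.

Lemma decideP P : reflect P (decide P).
Proof. by rewrite /decide; case: excluded_middle_informative => h; constructor. Qed.

(** The intended meaning of the labels. If [Q] depends only on the first [n] edges, the choice of
    the path beyond [v] is immaterial. *)
Definition reached (Q : pth B -> Prop) om n (v : V B n) : Prop :=
  exists x, [/\ is_path x, src (x n) = v, min_below om n x & Q x].

Lemma reached_rng Q om n (e : E B n) : is_ordering om -> min_edge om e ->
  (forall x x', is_path x -> is_path x' -> agree n x x' -> Q x -> Q x') ->
  reached Q om (src e) <-> reached Q om (rng e).
Proof.
move=> oo me QQ; split=> -[x [px sx mx qx]].
  have [z [pz zx ze]] := path_extend px sx.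
  exists z; split=> //; first by rewrite -pz ze.
    move=> i; rewrite ltnS leq_eqVlt => /orP[/eqP->|lt]; first by rewrite ze.
    by rewrite zx //; apply: mx.
  by apply: QQ qx => // i /zx.
have xe : x n = e by apply: oo.2; [rewrite px|rewrite (mx n (ltnSn n)) me].
by exists x; split=> //; [rewrite xe|move=> i lt; apply/mx/ltnW].
Qed.

(** The meaning propagates along minimal edges exactly as [lab] does, so agreement at level [n0]
    persists above. *)
Lemma lab_reached Q om n0 ds n : is_ordering om -> n0 <= n ->
  (forall x x', is_path x -> is_path x' -> agree n0 x x' -> Q x -> Q x') ->
  ds = [seq decide (reached Q om v) | v <- enum (V B n0)] ->
  forall v : V B n, lab n0 ds om v <-> reached Q om v.
Proof.
move=> oo + QQ eds; elim: n => [|n IH].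
  rewrite leqn0 => /eqP n00; subst n0 => v /=.
  rewrite eds (nth_map v) ?nth_enum_rank -?cardE ?ltn_ord //.
  by split=> /decideP.
rewrite leq_eqVlt ltnS => /orP[/eqP nn|lt] w.
  subst n0; rewrite /= ltnSn.
  rewrite eds (nth_map w) ?nth_enum_rank -?cardE ?ltn_ord //.
  by split=> /decideP.
have [e re me] := level_order_onto (level_order_om n oo) (fib_gt0 w).
rewrite -re (lab_rng ds oo lt me) (IH lt); apply: reached_rng => // x x' px px' xx'.
by apply: QQ => //; apply: agree_le xx'.
Qed.

Lemma alive_of_perfect om : perfect om ->
  (exists x1 x2, [/\ max_path om x1, max_path om x2 & x1 <> x2]) ->
  exists n0 bs cs, alive n0 bs cs om.
Proof.
move=> [oo [phi [[pphi [cphi [psi [_ [_ [psiK _]]]]]] [mm [_ sphi]]]]] [x1 [x2 [mx1 mx2 x12]]].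
pose y1 := phi x1; pose y2 := phi x2.
have [N y12] : exists N, ~ agree N y2 y1.
  apply: NNPP => nN; apply: x12; rewrite -(psiK _ mx1.1) -(psiK _ mx2.1); congr psi.
  apply: functional_extensionality_dep => n; apply: NNPP => ne; apply: nN.
  by exists n.+1 => a; apply: ne; apply: esym (a n (ltnSn n)).
have [M HM] := uniform_modulus N cphi.
have ro := rev_ordering oo.
(* [Qa] depends on the first [N] edges and [Qb] on the first [M], so both are determined by a prefix
   of length [n0]. *)
pose n0 := maxn M N.
pose Qa x := agree N x y1; pose Qb x := agree N (phi x) y1.
have QA x x' : is_path x -> is_path x' -> agree n0 x x' -> Qa x -> Qa x'.
  by move=> _ _ /(agree_le (leq_maxr M N))/agree_sym; apply: agree_trans.
have QB x x' : is_path x -> is_path x' -> agree n0 x x' -> Qb x -> Qb x'.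
  move=> px px' /(agree_le (leq_maxl M N))/(HM _ _ px px')/agree_sym.
  exact: agree_trans.
exists n0, [seq decide (reached Qa om v) | v <- enum (V B n0)],
  [seq decide (reached Qb (rev om) v) | v <- enum (V B n0)] => n le.
have A := lab_reached oo le QA erefl; have C := lab_reached ro le QB erefl.
have minfrom y : min_path om y -> min_below om n y by move=> my i _; apply: my.2.
have my1 := mm _ mx1; have my2 := mm _ mx2.
split; last first.
  (* At every level from [n0] on, the minimal paths [y1] and [y2] pass through vertices with
     different labels. *)
  exists (src (y1 n)), (src (y2 n)) => eqA.
  have /A : reached Qa om (src (y1 n)) by exists y1; split=> //; [exact: my1.1|exact: minfrom].
  rewrite eqA => /A[x [px sx mx ax]]; apply: y12.
  apply: agree_trans ax => i lt; apply/esym.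
  apply: (min_below_agree oo px my2.1 sx mx (minfrom _ my2)).
  by rewrite (leq_trans lt) // (leq_trans (leq_maxr M N)).
(* A path through the maximal path to [src e] and then [e] has its first change at level [n], so its
   image runs through the minimal path to [src e'] and then [e']. *)
have image x e e' : is_path x -> x n = e -> min_below (rev om) n x -> rng e = rng e' ->
    om n e' = (om n e).+1 -> phi x n = e' /\ min_below om n (phi x).
  move=> px xn mx re he.
  have [||r h _ l] := sphi x n px.
  - by rewrite xn /max_edge re; have := oo.1 n e'; lia.
  - by move=> i /mx/(min_rev _ oo).
  by split=> //; apply: oo.2; rewrite ?r ?h xn.
apply/walkP => e e' re he.
have [z [pz sz mz]] := min_path_to (src e) ro.
have ext x : is_path x -> src (x n) = src e -> min_below (rev om) n x ->
    exists x', [/\ is_path x', x' n = e, min_below (rev om) n x' & agree n x x'].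
  move=> px sx mx; have [x' [px' xx' xe]] := path_extend px sx.
  by exists x'; split=> // i lt; rewrite xx' //; apply: mx.
apply/idP/idP => [/A[y [py sy my ay]]|/C[x [px sx mx bx]]].
  apply/C; have [x [px xe mx _]] := ext z pz sz mz.
  have [pe pm] := image x e e' px xe mx re he.
  exists x; split=> //; first by rewrite xe.
  apply: agree_trans ay => i lt.
  apply: (min_below_agree oo (pphi _ px) py _ pm my); first by rewrite pe sy.
  by rewrite (leq_trans lt) // (leq_trans (leq_maxr M N)).
(* The witness need not continue with [e]; replacing its tail preserves [Qb], which only sees the
   first [n0] edges. *)
apply/A; have [x' [px' xe mx' xx']] := ext x px sx mx.
have [pe pm] := image x' e e' px' xe mx' re he.
exists (phi x'); split=> //; [exact: pphi|by rewrite pe|].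
exact: (QB x x' px px' (agree_le le xx') bx).
Qed.

Lemma perfect_null j : simple_bratteli B -> 1 < j -> mu_full (@O_j B j) -> mu_zero (@perfect B).
Proof.
move=> sB j1 nO.
(* The triples of [n0] and two initial label lists are enumerated by [unpickle]; an index that
   encodes no triple gives the empty set. *)
pose T i om := exists2 p : nat * seq bool * seq bool, unpickle i = Some p & alive p.1.1 p.1.2 p.2 om.
apply: (null_sub _ (null_union_fincov (T := T) nO _)); last first.
  move=> i r r0; rewrite /T; case: (unpickle i) => [p|]; last first.
    by apply: fincov0 (ltW r0) => om _ [].
  apply: fincov_sub (fincov_alive p.1.1 p.1.2 p.2 sB r0) => om _ [q [<-]]; exact.
move=> om oo pom; have [[_ [f [fi fP]]]|] := classic (O_j j om); last by left.
right; have [|n0 [bs [cs al]]] := alive_of_perfect pom.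
  exists (f (Ordinal (ltnW j1))), (f (Ordinal j1)); split; [apply/fP|apply/fP|].
  - by exists (Ordinal (ltnW j1)).
  - by exists (Ordinal j1).
  by move=> /fi.
by exists (pickle (n0, bs, cs)), (n0, bs, cs); first exact: pickleK.
Qed.

End PerfectAlive.

Theorem mainTheorem20 (B : bratteli) :
  aperiodic B -> simple_bratteli B -> finite_rank B ->
  (mu_full (@O_j B 1) -> mu_full (@perfect B)) /\
  (forall j : nat, 1 < j -> mu_full (@O_j B j) -> mu_zero (@perfect B)).
Proof.
move=> _ sB _; split; first exact: perfect_full.
by move=> j; apply: perfect_null.
Qed.
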